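(* Let $G$ be a connected $k$-regular graph of order $n$, where $k\ge 2$. If $G$ contains no subgraph (not necessarily induced) isomorphic to the $5$-cycle $C_5$, then \[ f_o(L(G))\ge \frac{n}{2}, \] where $L(G)$ is the line graph of $G$.
   Context: All graphs are finite and simple. An induced subgraph of a graph is called odd if every vertex of it has odd degree in it. $f_o(G)$ denotes the maximum order of an odd induced subgraph of $G$. $L(G)$ is the line graph of $G$. *)

(* Defs.v *)
From mathcomp Require Import all_boot.
Set Implicit Arguments. Unset Strict Implicit. Unset Printing Implicit Defensive.

Section Graphs.
Variable T : finType.

Definition simple_graph (g : rel T) : Prop := symmetric g /\ irreflexive g.

Definition connected (g : rel T) : Prop := forall x y, connect g x y.

Definition regular (g : rel T) (k : nat) : Prop :=
  forall x, #|[set y | g x y]| = k.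

Definition has_C5 (g : rel T) : Prop :=
  exists x0 x1 x2 x3 x4 : T,
    uniq [:: x0; x1; x2; x3; x4] /\
    [&& g x0 x1, g x1 x2, g x2 x3, g x3 x4 & g x4 x0].

Definition edge_set (g : rel T) : {set {set T}} :=
  [set e | [exists x, exists y, g x y && (e == [set x; y])]].

Definition LV (g : rel T) := {e : {set T} | e \in edge_set g}.

Definition line_rel (g : rel T) : rel (LV g) :=
  fun e f => (e != f) && (val e :&: val f != set0).
End Graphs.

Definition odd_induced (V : finType) (r : rel V) (S : {set V}) : bool :=
  [forall v in S, odd #|[set w in S | r v w]|].

Definition f_o (V : finType) (r : rel V) : nat :=
  \max_(S : {set V} | odd_induced r S) #|S|.
Arguments line_rel {T} g.
Arguments edge_set {T} g.

(* Main.v *)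
(* A set of edges F induces an odd subgraph of L(G) iff each edge of F joins a
   vertex of odd F-degree to one of even F-degree.  If A and B are the colour
   classes of a tree in G and |A| is even, the A-join in the tree (the edge set
   whose odd-degree vertices are exactly those of A) is such a set, with at least
   |A| edges.  Hence every connected piece with m vertices contributes at least
   the largest even number not exceeding (m + 1) / 2, which suffices for
   n = 0, 3 mod 4.
   For n = 2 mod 4 (resp. n = 1 mod 4, where k is even) it is enough to cut one
   (resp. two) P_3's off the rest of G, keeping it connected, or to find a
   spanning tree with unbalanced colour classes.  The P_3's are the initial
   vertices of a longest path.  If the rest is disconnected, rerouting the path
   through an unreached component gives a path whose end w has all its neighbours
   close by on the path; then w is adjacent to the second and the third vertex of
   the path, so as a leaf it can receive either colour.  One such leaf unbalances
   a tree when n = 2 mod 4.  When n = 1 mod 4 and k >= 4, excluding C_5 makes the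
   rerouted path a longest one, and rerouting it in turn gives two such leaves.
   For k = 2 a longest path spans G. *)
Require Import Defs.
From mathcomp Require Import all_boot.
From mathcomp Require Import zify.
Set Implicit Arguments. Unset Strict Implicit. Unset Printing Implicit Defensive.

Section OddJoins.
Variables (T : finType) (g : rel T).
Hypotheses (g_sym : symmetric g) (g_irr : irreflexive g).

(* [A] and [B] are the colour classes of a tree in [g]. *)
Inductive btree : {set T} -> {set T} -> Prop :=
| btree_root x : btree [set x] set0
| btree_swap A B : btree A B -> btree B A
| btree_leaf A B x y :
    btree A B -> y \in A -> x \notin A :|: B -> g x y -> btree A (x |: B).

(** * Degrees in an edge set and double counting *)

Definition deg (F : {set {set T}}) v := #|[set e in F | v \in e]|.

Lemma sum_deg (F : {set {set T}}) (A : {set T}) :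
  \sum_(v in A) deg F v = \sum_(e in F) #|e :&: A|.
Proof.
have E v : deg F v = \sum_(e in F) (v \in e).
  rewrite /deg -sum1_card big_mkcond [RHS]big_mkcond /=; apply: eq_bigr => e _.
  by rewrite inE; case: (e \in F); case: (v \in e).
under eq_bigr do rewrite E.
rewrite exchange_big /=; apply: eq_bigr => e _.
rewrite -sum1_card big_mkcond [RHS]big_mkcond /=; apply: eq_bigr => v _.
by rewrite inE; case: (v \in A); case: (v \in e).
Qed.

Lemma edgeP e :
  reflect (exists x y, [/\ g x y, x != y & e = [set x; y]]) (e \in edge_set g).
Proof.
rewrite inE; apply: (iffP existsP) => [[x /existsP[y /andP[gxy /eqP->]]]|].
  by exists x, y; split=> //; apply: contraTneq gxy => ->; rewrite g_irr.
by case=> x [y [gxy _ ->]]; exists x; apply/existsP; exists y; rewrite gxy eqxx.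
Qed.

(** Incidences are double counted. An odd [#|T|] thus forces [k] to be even, so for n = 1 mod 4 only
    [k = 2] and [k >= 4] occur. *)
Lemma handshake k : regular g k -> ~~ odd (#|T| * k).
Proof.
move=> reg.
have E : \sum_(v in [set: T]) deg (edge_set g) v = #|T| * k.
  rewrite -[#|T|]cardsT -sum_nat_const; apply: eq_bigr => v _; rewrite -(reg v) /deg.
  have inj : {in [set y | g v y] &, injective (fun y => [set v; y])}.
    move=> x y; rewrite !inE => gx gy /setP/(_ x); rewrite !inE eqxx orbT.
    case: (x =P v) => [xv|_]; first by rewrite xv g_irr in gx.
    by move/esym/eqP.
  rewrite -(card_in_imset inj); apply: eq_card => e; rewrite inE; apply/andP/imsetP.
    case=> /edgeP[x [y [gxy _ ->]]]; rewrite !inE => /orP[/eqP->|/eqP->].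
      by exists y; rewrite ?inE.
    by exists x; rewrite ?inE 1?g_sym // setUC.
  case=> y; rewrite inE => gvy ->; split; last by rewrite !inE eqxx.
  by apply/edgeP; exists v, y; split=> //; apply: contraTneq gvy => ->; rewrite g_irr.
rewrite -E sum_deg (eq_bigr (fun=> 2)) ?sum_nat_const ?oddM ?andbF //.
move=> _ /edgeP[x [y [_ xy ->]]]; by rewrite setIT cards2 xy.
Qed.

(** * Odd joins and the line graph *)

(* An edge set witnessing [odd_join W m] spans, in the line graph, an odd induced
   subgraph: each of its edges has one end of odd and one of even degree. *)
Definition odd_join (W : {set T}) m := exists (A : {set T}) (F : {set {set T}}),
  [/\ A \subset W, #|A| = m,
      forall e, e \in F -> [/\ e \in edge_set g, e \subset W & #|e :&: A| = 1]
    & forall v, odd (deg F v) = (v \in A)].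

Lemma deg0 v : deg set0 v = 0.
Proof. by apply: eq_card0 => e; rewrite !inE. Qed.

Lemma odd_join0 W : odd_join W 0.
Proof.
exists set0, set0; split=> [||e|v]; rewrite ?sub0set ?cards0 ?deg0 ?inE //.
Qed.

(** The two edge sets share no vertex, so the degrees add and at every vertex one of them is
    zero. *)
Lemma odd_joinU (W1 W2 : {set T}) m1 m2 : [disjoint W1 & W2] -> odd_join W1 m1 -> odd_join W2 m2 ->
  odd_join (W1 :|: W2) (m1 + m2).
Proof.
move=> dis [A1 [F1 [AW1 <- F1P p1]]] [A2 [F2 [AW2 <- F2P p2]]].
have FW1 e : e \in F1 -> e \subset W1 by case/F1P.
have FW2 e : e \in F2 -> e \subset W2 by case/F2P.
have dI (X Y : {set T}) : X \subset W1 -> Y \subset W2 -> X :&: Y = set0.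
  move=> XW YW; apply/eqP; rewrite setI_eq0.
  exact: disjointWl XW (disjointWr YW dis).
exists (A1 :|: A2), (F1 :|: F2); split.
- exact: setUSS.
- by rewrite cardsU dI // cards0 subn0.
- move=> e; rewrite inE => /orP[eF|eF].
    case: (F1P _ eF) => eE eW eA; split=> //; first exact: subset_trans eW (subsetUl _ _).
    by rewrite setIUr [e :&: A2]dI // setU0.
  case: (F2P _ eF) => eE eW eA; split=> //; first exact: subset_trans eW (subsetUr _ _).
  by rewrite setIUr [e :&: A1]setIC [A1 :&: e]dI // set0U.
move=> v.
have F12 : deg (F1 :|: F2) v = deg F1 v + deg F2 v.
  rewrite /deg -[RHS]subn0; set X := [set e in F1 | _]; set Y := [set e in F2 | _].
  have -> : [set e in F1 :|: F2 | v \in e] = X :|: Y.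
    by apply/setP=> e; rewrite !inE andb_orl.
  rewrite cardsU; congr (_ - _); apply: eq_card0 => e; rewrite !inE.
  apply/negP=> /andP[/andP[eF1 ve] /andP[eF2 _]].
  have := dI _ _ (FW1 _ eF1) (FW2 _ eF2); rewrite setIid => e0.
  by rewrite e0 inE in ve.
rewrite F12 oddD p1 p2 inE; case v1: (v \in A1); case v2: (v \in A2) => //.
by have /setP/(_ v) := dI _ _ AW1 AW2; rewrite !inE v1 v2.
Qed.

Lemma odd_joinS (W W' : {set T}) m : W \subset W' -> odd_join W m -> odd_join W' m.
Proof.
move=> sWW' [A [F [AW Am FP pF]]]; exists A, F; split=> //; first exact: subset_trans sWW'.
by move=> e /FP[eE eW eA]; split=> //; apply: subset_trans sWW'.
Qed.

(** In the line graph an edge xy of [F] has deg x + deg y - 2 neighbours in [F], an odd number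
    because exactly one of x, y is in [A]. Vertices of [A] have odd, hence positive, degree and each
    edge has one end in [A], so [#|A| <= #|F|]. *)
Lemma odd_join_leq_f_o W m : odd_join W m -> m <= f_o (line_rel g).
Proof.
case=> A [F [_ <- FP pF]].
have leF : #|A| <= #|F|.
  have -> : #|F| = \sum_(v in A) deg F v.
    by rewrite sum_deg -sum1_card; apply: eq_bigr => e /FP[].
  rewrite -sum1_card; apply: leq_sum => v vA.
  by have := pF v; rewrite vA; case: (deg F v).
pose S := [set v : LV g | val v \in F].
have valS (P : pred {set T}) :
    #|[set w in S | P (val w)]| = #|[set e in F | P e]|.
  rewrite -(card_imset _ val_inj); apply: eq_card => e; apply/imsetP/idP.
    by case=> w; rewrite !inE => wP ->.
  rewrite inE => /andP[eF Pe]; have [eE _ _] := FP _ eF.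
  by exists (Sub e eE); rewrite ?inE ?SubK ?eF.
apply: leq_trans leF _; have -> : #|F| = #|S|.
  have idT (U : finType) (X : {set U}) : [set z in X | true] = X.
    by apply/setP=> z; rewrite inE andbT.
  by have := valS predT; rewrite !idT.
suff : odd_induced (line_rel g) S by apply: (@leq_bigmax_cond _ _ (fun S : {set LV g} => #|S|)).
apply/forallP=> v; apply/implyP; rewrite inE => vF.
rewrite /line_rel.
rewrite (_ : #|_| = #|[set e in F | (val v != e) && (val v :&: e != set0)]|); last first.
  by rewrite -valS.
have [/edgeP[x [y [gxy xy ve]]] _ eA] := FP _ vF.
set e := val v in vF ve eA *.
have dx z : z \in e -> deg F z = #|[set f in F | (e != f) && (z \in f)]|.+1.
  move=> ze; rewrite /deg (cardsD1 e) !inE vF ze /=; congr _.+1.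
  by apply: eq_card => f; rewrite !inE eq_sym; case: (f \in F) => //=; rewrite andbF.
have xe : x \in e by rewrite ve !inE eqxx.
have ye : y \in e by rewrite ve !inE eqxx orbT.
have meet f : (e :&: f != set0) = (x \in f) || (y \in f).
  apply/set0Pn/idP => [[z]|]; first by rewrite ve !inE => /andP[/orP[]/eqP-> ->]; rewrite ?orbT.
  by case/orP=> ?; [exists x | exists y]; rewrite inE ?xe ?ye.
set X := [set f in F | (e != f) && (x \in f)].
set Y := [set f in F | (e != f) && (y \in f)].
have -> : [set f in F | (e != f) && (e :&: f != set0)] = X :|: Y.
  by apply/setP=> f; rewrite !inE meet -andb_orr -andb_orr.
(* The graph is simple: no edge other than [e] contains both [x] and [y]. *)
have XY : X :&: Y = set0.
  apply/setP=> f; rewrite !inE; apply/negP.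
  case/andP=> /and3P[fF ef xf] /and3P[_ _ yf].
  case: (FP _ fF) => /edgeP[a [b [_ ab fab]]] _ _; case/eqP: ef.
  rewrite ve; apply/eqP; rewrite eqEcard cards2 xy fab cards2 ab andbT.
  by apply/subsetP=> z; rewrite -fab !inE => /orP[]/eqP->.
rewrite cardsU XY cards0 subn0 oddD.
have px := pF x; have py := pF y; rewrite dx //= -/X in px; rewrite dx //= -/Y in py.
have : odd #|e :&: A| by rewrite eA.
have -> : #|e :&: A| = (x \in A) + (y \in A).
  rewrite -sum1_card (eq_bigl (fun z => (z \in e) && (z \in A))); last by move=> z; rewrite inE.
  rewrite big_mkcondr /= ve big_setU1 ?inE //= big_set1.
  by case: (x \in A); case: (y \in A).
by rewrite oddD !oddb -px -py; case: (odd _); case: (odd _).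
Qed.

(** * Joins in trees *)

Definition cross (A B e : {set T}) :=
  exists a b, [/\ a \in A, b \in B, g a b & e = [set a; b]].

Lemma btree_disjoint A B : btree A B -> [disjoint A & B].
Proof.
elim=> [x|A' B' _|A' B' x y _ dis yA]; first by rewrite -setI_eq0 setI0.
  by rewrite disjoint_sym.
rewrite inE negb_or => /andP[xA _] _.
by rewrite -setI_eq0 setIUr setU_eq0 !setI_eq0 dis disjoint_sym disjoints1 xA.
Qed.

(** Induction on leaves: a leaf [x] outside [X] gets no edge; a leaf [x] in [X] must use its edge to
    [y], which toggles [y] in the set required from the smaller tree. *)
Lemma btree_join A B : btree A B -> forall X : {set T}, X \subset A :|: B -> ~~ odd #|X| ->
  exists2 F : {set {set T}}, forall e, e \in F -> cross A B e
    & forall v, odd (deg F v) = (v \in X).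
Proof.
elim=> [x|{}A {}B _ IH|{}A {}B x y _ IH yA xAB gxy] X.
- rewrite setU0 => Xx oX; exists set0 => [e|v]; first by rewrite inE.
  rewrite deg0; move: Xx oX; rewrite subset1 => /orP[]/eqP->; rewrite ?cards1 //.
  by rewrite inE.
- rewrite setUC => XAB oX; have [F FP pF] := IH X XAB oX; exists F => // e /FP.
  by case=> a [b [aA bB gab ->]]; exists b, a; rewrite g_sym setUC.
have cr e : cross A B e -> cross A (x |: B) e.
  by case=> a [b [aA bB gab ->]]; exists a, b; rewrite aA gab !inE bB orbT.
rewrite setUCA => XAB oX; have [xX|xX] := boolP (x \in X); last first.
  have [|F FP pF] := IH X _ oX.
    apply/subsetP=> z zX; have := subsetP XAB _ zX.
    by rewrite in_setU1 => /orP[/eqP zx|//]; rewrite -zx zX in xX.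
  by exists F => // e /FP/cr.
have yx : y != x by apply: contraTneq gxy => ->; rewrite g_irr.
(* The symmetric difference of [X :\ x] and [[set y]], whose size has the parity of [#|X|]. *)
pose X' := if y \in X then X :\ x :\ y else y |: (X :\ x).
have memX' v : (v \in X') = (v \in X :\ x) (+) (v == y).
  rewrite /X'; case: ifP => yX; rewrite !inE; case: (v =P y) => [->|_] //=;
  by rewrite ?yX ?yx ?addbF ?addbT.
have [||F FP pF] := IH X'.
- apply/subsetP=> z; rewrite memX' !inE; case: (z =P y) => [->|_]; first by rewrite yA.
  rewrite addbF => /andP[zx zX]; have := subsetP XAB _ zX.
  by rewrite !inE (negPf zx).
- move: oX; rewrite (cardsD1 x) xX add1n /= negbK /X'; case: ifP => yX.
    by rewrite (cardsD1 y) !inE yX yx.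
  by rewrite cardsU1 !inE yX andbF /= => ->.
have FW e : e \in F -> x \notin e.
  move=> /FP[a [b [aA bB _ ->]]]; apply: contraNN xAB.
  by rewrite !inE => /orP[]/eqP->; rewrite ?aA ?bB ?orbT.
exists ([set x; y] |: F) => [e|v].
  rewrite in_setU1 => /orP[/eqP->|/FP/cr//].
  by exists y, x; split; rewrite ?setU11 1?g_sym 1?setUC.
have -> : deg ([set x; y] |: F) v = (v \in [set x; y]) + deg F v.
  rewrite /deg (cardsD1 [set x; y]) !inE eqxx /=; congr (_ + _); apply: eq_card => e.
  rewrite !inE; case: (e =P _) => [->|_] //=.
  by apply/esym/negP=> /andP[/FW]; rewrite !inE eqxx.
rewrite oddD pF oddb memX' !inE; case: (v =P x) => [->|_] /=.
  by rewrite xX eq_sym (negPf yx).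
by case: (v == y); case: (v \in X).
Qed.

(** Undoing the construction leaf by leaf lowers one class by one at a time, so every positive size
    of [A] is met on the way. It is proved for both classes at once because [btree_swap] exchanges
    them. *)
Lemma btree_trim A B : btree A B -> forall m, 0 < m -> m <= #|A| ->
  exists A' B', [/\ btree A' B', A' \subset A, B' \subset B & #|A'| = m].
Proof.
move=> bAB; pose Q (A B : {set T}) := forall m, 0 < m -> m <= #|A| ->
  exists A' B', [/\ btree A' B', A' \subset A, B' \subset B & #|A'| = m].
suff: Q A B /\ Q B A by case.
elim: bAB => [x|{}A {}B _ [? ?]|{}A {}B x y bAB [Q1 Q2] yA xAB gxy] //.
  split=> m m0; rewrite ?cards1 ?cards0 => m1; last by move: m0 m1; case: m.
  exists [set x], set0; split=> //; [exact: btree_root | rewrite cards1; lia].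
have sB : B \subset x |: B by apply: subsetUr.
split=> m m0 mA.
  have [A' [B' [? ? ? ?]]] := Q1 m m0 mA.
  by exists A', B'; split=> //; apply: subset_trans sB.
have [mB|mB] := leqP m #|B|.
  have [A' [B' [? ? ? ?]]] := Q2 m m0 mB.
  by exists A', B'; split=> //; apply: subset_trans sB.
exists (x |: B), A; split=> //; first by apply: btree_swap; apply: btree_leaf gxy.
apply/eqP; rewrite eqn_leq mA andbT cardsU1; move: mB; case: (x \notin B) => /=; lia.
Qed.

(** The trimmed class itself is the set of odd vertices: every edge of the tree has exactly one end
    in it. *)
Lemma btree_odd_join_side A B m : btree A B -> ~~ odd m -> m <= #|A| -> odd_join (A :|: B) m.
Proof.
move=> bAB om mA; have [->|m0] := posnP m; first exact: odd_join0.
have [A' [B' [bAB' sA sB cA']]] := btree_trim bAB m0 mA.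
have [||F FP pF] := btree_join bAB' (X := A'); rewrite ?subsetUl ?cA' //.
apply: (@odd_joinS (A' :|: B')); first exact: setUSS.
exists A', F; split=> //; first exact: subsetUl.
move=> _ /FP[a [b [aA bB gab ->]]].
have bA : b \notin A'.
  apply/negP=> bA; have := btree_disjoint bAB'; rewrite -setI_eq0 => /eqP/setP/(_ b).
  by rewrite !inE bA bB.
split.
- by rewrite inE; apply/existsP; exists a; apply/existsP; exists b; rewrite gab eqxx.
- by apply/subsetP=> z; rewrite !inE => /orP[]/eqP->; rewrite ?aA ?bB ?orbT.
rewrite (_ : _ :&: _ = [set a]) ?cards1 //; apply/setP=> z; rewrite !inE.
by case: (z =P a) => [->|_] //=; case: (z =P b) => [->|_] //=; apply/negbTE.
Qed.

Lemma btree_odd_join A B m : btree A B -> ~~ odd m -> 2 * m <= #|A :|: B|.+1 ->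
  odd_join (A :|: B) m.
Proof.
move=> bAB om; rewrite cardsU (_ : A :&: B = set0); last first.
  by apply/eqP; rewrite setI_eq0 btree_disjoint.
rewrite cards0 => mAB; have [mA|mA] := leqP m #|A|; first exact: btree_odd_join_side.
rewrite setUC; apply: btree_odd_join_side om _; [exact: btree_swap | lia].
Qed.

(** * Paths and growing trees *)

Definition gpath s := uniq s && sorted g s.

Lemma gpath_drop i s : gpath s -> gpath (drop i s).
Proof. by case/andP=> us gs; rewrite /gpath drop_uniq ?drop_sorted. Qed.

Lemma gpath_take i s : gpath s -> gpath (take i s).
Proof. by case/andP=> us gs; rewrite /gpath take_uniq ?take_sorted. Qed.

Lemma gpath_cons x y s :
  gpath (x :: y :: s) = [&& x \notin y :: s, g x y & gpath (y :: s)].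
Proof.
by rewrite /gpath cons_uniq /=; case: (x \notin _); case: (g x y); rewrite ?andbF.
Qed.

(** This records the colours along a path: a vertex adjacent to two consecutive vertices of it sees
    both classes. *)
Definition alternates (A B : {set T}) :=
  sorted (fun x y => (x \in A) && (y \in B) || (x \in B) && (y \in A)).

Lemma alternatesS (A B A' B' : {set T}) s : A \subset A' -> B \subset B' ->
  alternates A B s -> alternates A' B' s.
Proof.
move=> /subsetP sA /subsetP sB; apply: sub_sorted => x y.
by case/orP=> /andP[xX yY]; apply/orP; [left | right]; rewrite ?(sA, sB).
Qed.

(** The vertices of [Q] are attached from the last to the first, each as a leaf at its successor and
    in the class opposite to it. *)
Lemma btree_cat A B Q z s : btree A B -> z \in A :|: B -> gpath (Q ++ z :: s) ->
  (forall x, x \in Q -> x \notin A :|: B) -> alternates A B (z :: s) ->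
  exists A' B', [/\ btree A' B', A \subset A', B \subset B',
    A' :|: B' = [set x in Q] :|: (A :|: B) & alternates A' B' (Q ++ z :: s)].
Proof.
move=> bAB zAB; elim: Q => [_ _ alt|x Q IH gQ outQ alt].
  by exists A, B; split=> //; apply/setP=> x; rewrite !inE.
(* [y] is the successor of [x] on the path: the next vertex of [Q], or [z] if there is none. *)
pose y := head z Q; pose s' := behead (Q ++ z :: s).
have Es : Q ++ z :: s = y :: s' by rewrite /y /s'; case: (Q).
move: gQ; rewrite cat_cons Es gpath_cons -Es => /and3P[xs gxy gQ].
have [|A' [B' [bAB' sA sB E altQ]]] := IH gQ _ alt.
  by move=> v vQ; apply: outQ; rewrite inE vQ orbT.
have yAB' : y \in A' :|: B'.
  rewrite E /y; case: (Q) => [|u Q'] /=; first by rewrite in_setU zAB orbT.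
  by rewrite !inE eqxx.
have xAB' : x \notin A' :|: B'.
  rewrite E in_setU negb_or outQ ?mem_head // inE andbT.
  by move: xs; rewrite mem_cat negb_or => /andP[].
have EQ (X : {set T}) : X = [set u in Q] :|: (A :|: B) ->
    x |: X = [set u in x :: Q] :|: (A :|: B).
  by move=> ->; apply/setP=> u; rewrite !inE orbA.
move: (yAB'); rewrite in_setU => /orP[yA|yB].
  exists A', (x |: B'); split=> //.
  - exact: btree_leaf gxy.
  - exact: subset_trans sB (subsetUr _ _).
  - by rewrite setUCA; apply: EQ.
  rewrite Es /= /alternates /= setU11 yA orbT /= -/(sorted _ (y :: s')) -Es.
  exact: alternatesS (subxx _) (subsetUr _ _) altQ.
exists (x |: A'), B'; split=> //.
- by apply: btree_swap; apply: btree_leaf gxy => //; [exact: btree_swap | rewrite setUC].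
- exact: subset_trans sA (subsetUr _ _).
- by rewrite -setUA; apply: EQ.
rewrite Es /= /alternates /= setU11 yB /= -/(sorted _ (y :: s')) -Es.
exact: alternatesS (subsetUr _ _) (subxx _) altQ.
Qed.

Lemma btree_path s : gpath s -> s != [::] ->
  exists A B, [/\ btree A B, A :|: B = [set x in s] & alternates A B s].
Proof.
case/lastP: s => // Q z; rewrite -cats1 => gQ _.
have zQ : z \notin Q.
  by case/andP: gQ; rewrite cats1 rcons_uniq => /andP[].
have [|||A' [B' [? _ _ E ?]]] := btree_cat (btree_root z) _ gQ.
- by rewrite !inE eqxx.
- by move=> x xQ; rewrite !inE orbF; apply: contraTneq xQ => ->.
- by [].
exists A', B'; split=> //; rewrite E; apply/setP=> x.
by rewrite !inE mem_cat inE orbF.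
Qed.

Lemma btree_neq0 A B : btree A B -> A :|: B != set0.
Proof.
elim=> [x|{}A {}B _|{}A {}B x y _ _ _ _ _]; last 2 first.
- by rewrite setUC.
- by apply/set0Pn; exists x; rewrite !inE eqxx orbT.
by apply/set0Pn; exists x; rewrite !inE eqxx.
Qed.

Lemma btree_grow A B (Z : {set T}) : btree A B -> A :|: B \subset Z ->
  exists A' B', [/\ btree A' B', A \subset A', B \subset B', A' :|: B' \subset Z
    & forall x y, x \in A' :|: B' -> y \in Z :\: (A' :|: B') -> ~~ g y x].
Proof.
have [m] := ubnP #|Z :\: (A :|: B)|; elim: m A B => // m IH A B lem bAB sABZ.
have [/existsP[x /existsP[y /and3P[xAB yZ gyx]]]|noedge] := boolP
  [exists x, exists y, [&& x \in A :|: B, y \in Z :\: (A :|: B) & g y x]]; last first.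
  exists A, B; split=> // x y xAB yZ; apply: contra noedge => gyx.
  by apply/existsP; exists x; apply/existsP; exists y; rewrite xAB yZ.
have yAB : y \notin A :|: B by case/setDP: yZ.
have step (X : {set T}) : X = y |: (A :|: B) -> #|Z :\: X| < m /\ X \subset Z.
  move=> ->; split; last by rewrite subUset sABZ andbT sub1set; case/setDP: yZ.
  by rewrite [y |: _]setUC -setDDl; move: lem; rewrite (cardsD1 y) yZ.
move: xAB; rewrite in_setU => /orP[xA|xB].
  have [lem' sZ] := step (A :|: (y |: B)) (setUCA _ _ _).
  have [A' [B' [? ? sB ? ?]]] := IH A (y |: B) lem' (btree_leaf bAB xA yAB gyx) sZ.
  by exists A', B'; split=> //; apply: subset_trans sB; apply: subsetUr.
have [lem' sZ] := step ((y |: A) :|: B) (esym (setUA _ _ _)).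
have bBA : btree (y |: A) B.
  by apply: btree_swap; apply: btree_leaf gyx => //; [exact: btree_swap | rewrite setUC].
have [A' [B' [? sA ? ? ?]]] := IH (y |: A) B lem' bBA sZ.
by exists A', B'; split=> //; apply: subset_trans sA; apply: subsetUr.
Qed.

(** * Spanning trees and detours in a connected graph *)

Hypothesis g_conn : connected g.

Lemma connected_closed (D : {set T}) x0 :
  x0 \in D -> (forall x y, x \in D -> g x y -> y \in D) -> D = setT.
Proof.
move=> x0D clD; have cl : closed g D.
  by move=> x y gxy; apply/idP/idP => ?; [exact: clD gxy | apply: clD (y) _ _ _; rewrite // g_sym].
by apply/setP=> y; rewrite -(closed_connect cl (g_conn x0 y)) x0D inE.
Qed.

(** In a tree grown maximally inside [Z], an uncovered vertex of [Z] has no neighbour in the tree,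
    and none outside [Z] by hypothesis. The uncovered vertices would be closed under adjacency,
    against connectivity. *)
Lemma btree_span A B (Z : {set T}) : btree A B -> A :|: B \subset Z ->
  (forall z x, z \notin Z -> g z x -> x \in Z -> x \in A :|: B) ->
  exists A' B', [/\ btree A' B', A \subset A', B \subset B' & A' :|: B' = Z].
Proof.
move=> bAB sABZ out; have [A' [B' [bAB' sA sB sZ stop]]] := btree_grow bAB sABZ.
exists A', B'; split=> //; apply/eqP; rewrite eqEsubset sZ -setD_eq0.
apply/negPn/negP=> /set0Pn[d dD].
have [a aAB] := set0Pn _ (btree_neq0 bAB').
suff DT : Z :\: (A' :|: B') = setT.
  by have := in_setT a; rewrite -DT inE aAB.
apply: connected_closed dD _ => x y xD gxy; rewrite inE.
have -> /= : y \notin A' :|: B' by apply: contraTN gxy => yAB; apply: stop yAB xD.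
apply/negPn/negP=> yZ; case/setDP: xD => xZ /negP[].
by have := out y x yZ; rewrite g_sym gxy xZ => /(_ isT isT); apply/subsetP/setUSS.
Qed.

Lemma longest_seq (P : pred (seq T)) N s0 : P s0 ->
  (forall s, P s -> size s <= N) ->
  exists2 s, P s & forall s', P s' -> size s' <= size s.
Proof.
move=> Ps0 ub; pose p m := [exists t : m.-tuple T, P t].
have exp : exists m, p m by exists (size s0); apply/existsP; exists (in_tuple s0).
have ubp m : p m -> m <= N by case/existsP=> t /ub; rewrite size_tuple.
case: (ex_maxnP exp ubp) => m /existsP[t Pt] mm; exists t => // s' Ps'.
by rewrite size_tuple; apply: mm; apply/existsP; exists (in_tuple s').
Qed.

Lemma gpath_size s : gpath s -> size s <= #|T|.
Proof. by case/andP=> /card_uniqP <- _; apply: max_card. Qed.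

(* Take a vertex set [D] not reached from [drop N P] off the first [N] vertices
   of [P], let [nth i P] be the first vertex of [P] with a neighbour in [D], and
   extend [drop i P] into [D] by a path as long as possible: all neighbours of
   its end [w] are on it, close to [w]. *)
Lemma detour P N : gpath P -> (forall s, gpath s -> size s <= size P) ->
  0 < N <= size P -> N < #|T| ->
  (exists A B, btree A B /\ A :|: B = ~: [set x in take N P]) \/
  exists w Q i, [/\ gpath ((w :: Q) ++ drop i P),
    size (w :: Q) <= i < N, (forall x, x \in w :: Q -> x \notin P)
    & forall x, g w x -> x \in (w :: Q) ++ drop i P /\
        index x ((w :: Q) ++ drop i P) < size (w :: Q) + (N - i)].
Proof.
move=> gP maxP /andP[N0 NP] NT.
have uP : uniq P by case/andP: gP.
set R := [set x in take N P].
(* [S] is what is reached from [drop N P] without using [R]; it is empty when [N = size P]. *)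
have [S SP]: exists S : {set T}, [/\ (S = set0 \/ exists A B, btree A B /\ A :|: B = S),
    [set x in drop N P] \subset S, S \subset ~: R
    & forall x y, x \in S -> y \in ~: R :\: S -> ~~ g y x].
  have [d0|d0] := eqVneq (drop N P) [::].
    exists set0; split; [by left | | exact: sub0set | by move=> x y; rewrite inE].
    by rewrite d0; apply/subsetP=> x; rewrite !inE.
  have [A [B [bAB E _]]] := btree_path (gpath_drop N gP) d0.
  have sABZ : A :|: B \subset ~: R.
    rewrite E; apply/subsetP=> x; rewrite !inE => xd; apply/negP=> xt.
    have := uP; rewrite -(cat_take_drop N P) cat_uniq => /and3P[_ /hasPn/(_ x xd)].
    by rewrite xt.
  have [A' [B' [bAB' sA sB sZ stop]]] := btree_grow bAB sABZ.
  exists (A' :|: B'); split=> //; first by right; exists A', B'.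
  by rewrite -E; apply: setUSS.
case: SP => Salt dS SR stop.
have [D0|/set0Pn[d dD]] := eqVneq (~: R :\: S) set0.
  (* Everything off [R] is reached, and [S] is nonempty because [R] has at most [N < #|T|]
     vertices. *)
  left; have ES : S = ~: R by apply/eqP; rewrite eqEsubset SR -setD_eq0 D0 eqxx.
  case: Salt => [S0|[A [B [? E]]]]; last by exists A, B; rewrite -ES.
  have : #|R| <= N by rewrite cardsE (leq_trans (card_size _)) // size_take_min geq_minl.
  have /eqP : R = setT by rewrite -[R]setCK -ES S0 setC0.
  by move/eqP=> ->; rewrite cardsT leqNgt NT.
right; set D := ~: R :\: S in dD stop.
pose touched y := [exists x in D, g x y].
have hasP : has touched P.
  apply/negPn/negP=> /hasPn noP.
  have DT : D = setT.
    apply: connected_closed dD _ => x y xD gxy.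
    have yT : touched y by apply/existsP; exists x; rewrite xD.
    have yP : y \notin P by apply/negP=> /noP; rewrite yT.
    rewrite !inE (contraNN (@mem_take _ _ _ _) yP) andbT.
    by apply/negP=> yS; have := stop y x yS xD; rewrite gxy.
  have [p pR] : exists p, p \in R.
    case E: (take N P) (size_takel NP) N0 => [|p s]; first by move=> /= <-.
    by exists p; rewrite inE E mem_head.
  by have := in_setT p; rewrite -DT in_setD in_setC pR andbF.
have DP x : x \in D -> x \notin P.
  rewrite !inE -{2}(cat_take_drop N P) mem_cat negb_or => /andP[xS ->] /=.
  by apply: contraNN xS => xd; apply: (subsetP dS); rewrite inE.
pose i := find touched P; have iP : i < size P by rewrite -has_find.
set y := nth d P i; have ty : touched y by apply: nth_find.
have dropE : drop i P = y :: drop i.+1 P by apply: drop_nth.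
have noS x z : x \in D -> g x z -> z \notin S.
  by move=> xD gxz; apply/negP=> zS; have := stop z x zS xD; rewrite gxz.
(* The vertices of [P] from index [N] on are in [S] and have no neighbour in [D]. *)
have iN : i < N.
  rewrite ltnNge; apply/negP=> Ni; case/existsP: ty => x /andP[xD gxy].
  case/negP: (noS _ _ xD gxy); apply: (subsetP dS); rewrite inE.
  by rewrite /y -(subnKC Ni) -nth_drop mem_nth // size_drop ltn_sub2r // (leq_ltn_trans Ni).
pose pQ Q := [&& Q != [::], all (mem D) Q & gpath (Q ++ drop i P)].
case/existsP: (ty) => c /andP[cD gcy].
have pc : pQ [:: c].
  rewrite /pQ /= andbT dropE gpath_cons gcy -dropE gpath_drop // !andbT.
  by rewrite cD (contraNN (@mem_drop _ _ _ _) (DP _ cD)).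
have [|[|w Q] // /and3P[_ QD gQ] maxQ] := longest_seq pc (N := #|T|).
  move=> Q /and3P[_ _ /gpath_size]; apply: leq_trans.
  by rewrite size_cat leq_addr.
have wD : w \in D by case/andP: QD.
have sQ : size (w :: Q) <= i.
  by rewrite -[i in _ <= i](subKn (ltnW iP)) leq_subRL ?leq_subr // addnC -size_drop -size_cat maxP.
have inD x : x \in w :: Q -> x \in D by apply/allP.
exists w, Q, i; split=> //; first by rewrite sQ.
  by move=> x /inD/DP.
(* A neighbour of [w] in [D] is on [w :: Q] by maximality. Any other is outside [S], hence in [R],
   and its index in [P] is at least [i] by the choice of [i]. *)
move=> x gwx; have [xD|xD] := boolP (x \in D).
  have xQ : x \in w :: Q.
    apply/negPn/negP=> xQ; have := maxQ (x :: w :: Q); rewrite /pQ ltnn.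
    rewrite cat_cons gpath_cons -cat_cons gQ g_sym gwx mem_cat negb_or xQ.
    rewrite (contraNN (@mem_drop _ _ _ _) (DP _ xD)) /=.
    by move: QD => /= ->; rewrite xD => /(_ isT).
  by rewrite mem_cat index_cat xQ ltn_addr ?index_mem.
have xQ : x \notin w :: Q by apply: contra xD => /inD.
have xR : x \in R.
  by move: xD; rewrite in_setD in_setC (noS _ _ wD gwx) negbK.
rewrite inE in xR; have xP := mem_take xR.
have tx : touched x by apply/existsP; exists w; rewrite wD.
have ix : i <= index x P.
  rewrite leqNgt; apply/negP=> /(before_find d); rewrite nth_index //.
  by rewrite tx.
have xi : x \notin take i P by rewrite in_take // -leqNgt.
have := xR; rewrite in_take // => xN.
have xd : x \in drop i P.
  by move: xP; rewrite -[in X in X -> _](cat_take_drop i P) mem_cat (negPf xi).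
have ixE : index x P = i + index x (drop i P).
  rewrite -[in LHS](cat_take_drop i P) index_cat (negPf xi) size_takel //.
  exact: ltnW.
rewrite mem_cat xd orbT index_cat (negPf xQ); split=> //.
by rewrite ltn_add2l -(ltn_add2l i) -ixE subnKC // ltnW.
Qed.

(** * Neighbours of a path end, and short paths *)

Lemma nbr_count k w s M : regular g k ->
  (forall x, g w x -> x \in w :: s /\ index x (w :: s) < M) ->
  k <= count (fun j => g w (nth w (w :: s) j)) (iota 1 M.-1).
Proof.
move=> reg nbr; rewrite -(reg w) -size_filter -(size_map (nth w (w :: s))).
apply: leq_trans (card_size _); apply: subset_leq_card; apply/subsetP=> x.
rewrite inE => gwx; have [xs xM] := nbr x gwx.
apply/mapP; exists (index x (w :: s)); last by rewrite nth_index.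
rewrite mem_filter nth_index // gwx mem_iota /=.
case: eqP => [wx|_] //; first by rewrite -wx g_irr in gwx.
by move: xM => /=; case: eqP => [wx|_]; [rewrite wx g_irr in gwx | case: (M)].
Qed.

Lemma gpath_C5 w s : gpath (w :: s) -> g w (nth w (w :: s) 4) -> has_C5 g.
Proof.
(* On a shorter path [nth] returns its default [w], which is not adjacent to itself. *)
case: s => [|a [|b [|c [|d s]]]] /=; rewrite ?g_irr // => gs gwd.
exists w, a, b, c, d; have /andP[us ss] := gpath_take 5 gs.
move: ss us; rewrite /= take0 => /and5P[-> -> -> -> _] us.
by rewrite [g d w]g_sym gwd.
Qed.

(** A P_3 yields 2 from 3 vertices; this surplus over one half makes up for the rounding in the rest
    of the graph. *)
Lemma odd_join_path3 s : gpath s -> size s = 3 -> odd_join [set x in s] 2.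
Proof.
move=> gs s3; have [|A [B [bAB E _]]] := btree_path gs; first by case: (s) s3.
rewrite -E; apply: btree_odd_join => //; rewrite E cardsE.
by case/andP: gs => /card_uniqP-> _; rewrite s3.
Qed.

Lemma odd_join_path6 s : gpath s -> size s = 6 -> odd_join [set x in s] 4.
Proof.
move=> gs s6; rewrite -(cat_take_drop 3 s).
have -> : [set x in take 3 s ++ drop 3 s] = [set x in take 3 s] :|: [set x in drop 3 s].
  by apply/setP=> x; rewrite !inE mem_cat.
apply: (@odd_joinU _ _ 2 2).
- have /andP[] := gs; rewrite -{1}(cat_take_drop 3 s) cat_uniq => /and3P[_ + _] _.
  move/hasPn=> dis; rewrite disjoint_sym disjoint_subset; apply/subsetP=> x.
  by rewrite !inE => /dis.
- by apply: odd_join_path3; [exact: gpath_take | rewrite size_takel // s6].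
- by apply: odd_join_path3; [exact: gpath_drop | rewrite size_drop s6].
Qed.

(** * Leaves that can take either colour *)

Definition bicolored (A B : {set T}) w :=
  (exists2 a, a \in A & g w a) /\ (exists2 b, b \in B & g w b).

Lemma alternates_bicolored (A B A' B' : {set T}) x y s w : A \subset A' -> B \subset B' ->
  alternates A B [:: x, y & s] -> g w x -> g w y -> bicolored A' B' w.
Proof.
move=> /subsetP sA /subsetP sB /andP[/orP[]/andP[xX yY] _] gx gy.
  by split; [exists x; first exact: sA | exists y; first exact: sB].
by split; [exists y; first exact: sA | exists x; first exact: sB].
Qed.

(** The larger class of the tree has at least [2 * j + 1] vertices, and [w] joins it. *)
Lemma odd_join_bicolored1 A B w j : btree A B -> A :|: B = ~: [set w] -> #|T| = 4 * j + 2 ->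
  bicolored A B w -> odd_join setT (2 * j + 2).
Proof.
move=> bAB E nT [[a aA gwa] [b bB gwb]].
have cAB : #|A| + #|B| = 4 * j + 1.
  have := cardsC1 w; rewrite -E cardsU nT (_ : A :&: B = set0) ?cards0; first lia.
  by apply/eqP; rewrite setI_eq0 btree_disjoint.
wlog cA : A B a b bAB E aA gwa bB gwb cAB / 2 * j + 1 <= #|A|.
  move=> W; have [cA|cA] := leqP (2 * j + 1) #|A|; first exact: (W A B a b).
  by apply: (W B A b a) => //; [exact: btree_swap | rewrite setUC | lia | lia].
have wAB : w \notin A :|: B by rewrite E !inE eqxx.
have bw : btree (w |: A) B.
  by apply: btree_swap; apply: btree_leaf gwb => //; [exact: btree_swap | rewrite setUC].
have -> : setT = (w |: A) :|: B by rewrite -setUA E setUCr.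
apply: btree_odd_join_side bw _ _; first by rewrite oddD oddM.
by move: wAB; rewrite cardsU1 inE negb_or => /andP[-> _]; lia.
Qed.

(** The larger class has at least [2 * j] vertices, and both [w] and [l] join it. *)
Lemma odd_join_bicolored2 A B w l j : btree A B -> A :|: B = ~: [set w; l] -> w != l ->
  #|T| = 4 * j + 1 -> bicolored A B w -> bicolored A B l -> odd_join setT (2 * j + 2).
Proof.
move=> bAB E wl nT [[a aA gwa] [b bB gwb]] [[a' aA' gla] [b' bB' glb]].
have cAB : #|A| + #|B| = 4 * j - 1.
  have := cardsC [set w; l]; rewrite cards2 wl -E cardsU nT.
  rewrite (_ : A :&: B = set0) ?cards0; first lia.
  by apply/eqP; rewrite setI_eq0 btree_disjoint.
wlog cA : A B a b a' b' bAB E aA gwa bB gwb aA' gla bB' glb cAB / 2 * j <= #|A|.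
  move=> W; have [cA|cA] := leqP (2 * j) #|A|; first exact: (W A B a b a' b').
  by apply: (W B A b a b' a') => //; [exact: btree_swap | rewrite setUC | lia | lia].
have wAB : w \notin A :|: B by rewrite E !inE eqxx.
have lAB : l \notin w |: A :|: B.
  by rewrite -setUA E !inE eqxx orbT orbF eq_sym.
have bw : btree (w |: A) B.
  by apply: btree_swap; apply: btree_leaf gwb => //; [exact: btree_swap | rewrite setUC].
have bl : btree (l |: (w |: A)) B.
  by apply: btree_swap; apply: btree_leaf glb => //; [exact: btree_swap | rewrite setUC].
have -> : setT = (l |: (w |: A)) :|: B.
  by rewrite -!setUA E setUA [[set l] :|: _]setUC setUCr.
apply: btree_odd_join_side bl _ _; first by rewrite oddD oddM.
move: wAB lAB; rewrite 2!cardsU1 [w \in A :|: B]inE [l \in _ :|: B]inE !negb_or.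
by case/andP=> -> _ /andP[-> _]; lia.
Qed.

(** The path without [w] contains all neighbours of [w], so it grows to a tree on all vertices but
    [w]; [x] and [y] keep opposite colours in it. *)
Lemma odd_join_switch1 w x y s j : gpath [:: w, x, y & s] ->
  (forall z, g w z -> z \in [:: w, x, y & s]) -> g w y -> #|T| = 4 * j + 2 ->
  odd_join setT (2 * j + 2).
Proof.
move=> gP nbr gwy nT; move: (gP); rewrite gpath_cons => /and3P[ws gwx gxs].
have [//|A [B [bAB E alt]]] := btree_path gxs.
have [||A' [B' [bAB' sA sB E']]] := btree_span (Z := ~: [set w]) bAB.
- by rewrite E; apply/subsetP=> z; rewrite !inE => zs; apply: contraTneq zs => ->.
- move=> z u; rewrite !inE negbK => /eqP-> /nbr uP uw; rewrite -in_setU E inE.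
  by move: uP; rewrite inE (negPf uw).
apply: odd_join_bicolored1 bAB' E' nT _.
exact: alternates_bicolored sA sB alt gwx gwy.
Qed.

(** The two paths share the tail [drop i P]. The tree on [P] without [l] is extended by [Q], so both
    paths, without their first vertices, alternate in it. It holds all neighbours of [l] and [w]
    other than these two, and grows to cover everything else. *)
Lemma odd_join_switch2 l x y s w Q i x' y' s' j :
  let P := [:: l, x, y & s] in
  gpath P -> (forall z, g l z -> z \in P) -> g l y ->
  0 < i < size P -> (forall z, z \in w :: Q -> z \notin P) ->
  gpath (w :: Q ++ drop i P) -> (forall z, g w z -> z \in w :: Q ++ drop i P) ->
  Q ++ drop i P = [:: x', y' & s'] -> g w y' -> #|T| = 4 * j + 1 ->
  odd_join setT (2 * j + 2).
Proof.
move=> P gP nbrl gly /andP[i0 iP] QP gW nbrw EW gwy nT.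
move: (gP); rewrite gpath_cons => /and3P[ls glx gxs].
have [//|A [B [bAB E alt]]] := btree_path gxs.
(* As [0 < i], the shared tail avoids [l]. *)
have dropE : drop i P = drop i.-1 [:: x, y & s] by case: (i) i0.
have [wxy gwx gQ] : [/\ w \notin [:: x', y' & s'], g w x' & gpath (Q ++ drop i P)].
  by move: gW; rewrite EW gpath_cons => /and3P[].
have Ed := drop_nth l iP; set z := nth l P i in Ed.
have zAB : z \in A :|: B.
  by rewrite E inE (mem_drop (n0 := i.-1)) // -dropE Ed mem_head.
have gQz : gpath (Q ++ z :: drop i.+1 P) by rewrite -Ed.
have outQ u : u \in Q -> u \notin A :|: B.
  move=> uQ; have uP : u \notin P by apply: QP; rewrite inE uQ orbT.
  by apply: contra uP; rewrite E inE => us; rewrite inE us orbT.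
have altz : alternates A B (z :: drop i.+1 P).
  by rewrite -Ed dropE; apply: drop_sorted.
have [A1 [B1 [bAB1 sA1 sB1 E1 alt1]]] := btree_cat bAB zAB gQz outQ altz.
rewrite -Ed EW in alt1.
have wP : w \notin P by apply: QP; apply: mem_head.
have memAB u : (u \in A1 :|: B1) = (u \in Q) || (u \in [:: x, y & s]).
  by rewrite E1 E in_setU !in_set.
have wl : w != l by apply: contraNneq wP => ->; apply: mem_head.
have [||A2 [B2 [bAB2 sA2 sB2 E2]]] := btree_span (Z := ~: [set w; l]) bAB1.
- apply/subsetP=> u; rewrite memAB in_setC in_set2 negb_or => uQP; apply/andP; split.
    apply: contraTneq uQP => ->; rewrite negb_or.
    move: wxy wP; rewrite -EW mem_cat negb_or => /andP[-> _] /=.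
    by apply: contra => wP; rewrite inE wP orbT.
  apply: contraTneq uQP => ->; rewrite negb_or ls andbT.
  by apply/negP=> lQ; have := QP l; rewrite inE lQ orbT mem_head => /(_ isT).
- move=> v u; rewrite !in_setC negbK !in_set2 negb_or memAB => /orP[]/eqP-> gu /andP[uw ul].
    have := nbrw u gu; rewrite in_cons (negPf uw) mem_cat /= => /orP[->//|].
    by rewrite dropE => /mem_drop->; rewrite orbT.
  by have := nbrl u gu; rewrite in_cons (negPf ul) /= => ->; rewrite orbT.
apply: odd_join_bicolored2 bAB2 E2 wl nT _ _.
  exact: alternates_bicolored sA2 sB2 alt1 gwx gwy.
by apply: alternates_bicolored alt glx gly; [apply: subset_trans sA2 | apply: subset_trans sB2].
Qed.

(** * Longest paths in 2-regular graphs *)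

(** The second neighbour of [l] is on the path and cannot be interior, where it would have degree
    three. So the path closes to a cycle, which no edge leaves, and connectivity makes it
    spanning. *)
Lemma two_regular_path l s : regular g 2 -> gpath (l :: s) ->
  (forall x, g l x -> x \in l :: s) -> g l (last l s) /\ forall x, x \in l :: s.
Proof.
move=> reg gP nbr.
have three x a b c : uniq [:: a; b; c] -> g x a -> g x b -> g x c -> False.
  move=> u ga gb gc; suff : #|[:: a; b; c]| <= #|[set y | g x y]|.
    by rewrite reg (card_uniqP u).
  by apply: subset_leq_card; apply/subsetP=> y; rewrite !inE => /or3P[]/eqP->.
case: s gP nbr => [|a s] gP nbr.
  suff : #|[set y | g l y]| = 0 by rewrite reg.
  apply: eq_card0 => x; rewrite inE; apply/negP=> glx; have := nbr x glx.
  by rewrite inE => /eqP xl; rewrite xl g_irr in glx.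
have [x /andP[glx xa]] : exists x, g l x && (x != a).
  have [/existsP//|/existsPn noP] := boolP [exists x, g l x && (x != a)].
  have : #|[set y | g l y]| <= #|[set a]|.
    apply: subset_leq_card; apply/subsetP=> y; rewrite !inE => gly.
    by have := noP y; rewrite gly negbK.
  by rewrite reg cards1.
have xs : x \in s.
  have := nbr x glx; rewrite !inE (negPf xa) /=; case: eqP => // xl.
  by rewrite xl g_irr in glx.
case/andP: (gP) => us; case/splitPr: xs us => p1 p2 us /= /andP[gla].
rewrite cat_path /= => /and3P[ps gpx px].
have lax : last a p1 \in a :: p1 by apply: mem_last.
have p20 : p2 = [::].
  case: p2 us px => // b p2 us /= /andP[gxb _].
  case: (three x l (last a p1) b); rewrite // 1?g_sym //.
  move: us; rewrite cons_uniq -cat_cons cat_uniq mem_cat negb_or.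
  case/and4P=> /andP[lp lx] _ /hasPn out /= /andP[xb _].
  have xm : x \in x :: b :: p2 by rewrite mem_head.
  have bm : b \in x :: b :: p2 by rewrite !inE eqxx orbT.
  rewrite /= !inE !negb_or andbT -andbA; apply/and3P; split.
  - by apply: contraNneq lp => ->.
  - by apply: contraNneq lx => ->.
  by apply: contraNneq (out b bm) => <-.
have el : last a (p1 ++ x :: p2) = x by rewrite p20 last_cat.
split; first by rewrite el.
clear gP nbr s; set s := a :: p1 ++ x :: p2.
have pP : path g l s by rewrite /s /= gla cat_path /= ps gpx px.
have cP : cycle g (l :: s).
  by rewrite (cycle_path l); apply/andP; split=> //; rewrite [last _ _]el g_sym.
have cl u v : u \in [set z in l :: s] -> g u v -> v \in [set z in l :: s].
  rewrite !inE -!in_cons => uls guv; apply/negPn/negP=> vls.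
  have [i t Et] := rot_to uls.
  have mem_t z : (z \in u :: t) = (z \in l :: s) by rewrite -Et mem_rot.
  have := cP; rewrite -(rot_cycle i) Et.
  have := us; rewrite -[[:: l, a & _]]/(l :: s) -(rot_uniq i) Et.
  (* This makes the two cycle neighbours of [u] distinct, so that [v] would be a third one. *)
  have : size t >= 2.
    by rewrite -ltnS -[(size t).+1]/(size (u :: t)) -Et size_rot /s /= size_cat /= addnS.
  move: vls; rewrite -mem_t; case/lastP: t {Et mem_t} => // [[|c t]] // z vt _ ut.
  rewrite /= rcons_path last_rcons => /and3P[guc _ gzu].
  apply: (three u v c z) => //; last by rewrite g_sym.
  move: vt ut; rewrite /= !(inE, mem_rcons) !negb_or.
  by case/and4P=> _ -> -> _ /and3P[_ /andP[-> _] _].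
move=> x0; have := connected_closed (x0 := l) _ cl.
by rewrite inE mem_head => /(_ isT)/setP/(_ x0); rewrite !inE.
Qed.

(** * Case analysis on the order modulo 4 *)

Definition longest P := gpath P /\ forall s, gpath s -> size s <= size P.

Lemma longest_nbr l s : longest (l :: s) -> forall x, g l x -> x \in l :: s.
Proof.
case=> gP maxP x glx; apply/negPn/negP=> xP.
by have := maxP (x :: l :: s); rewrite gpath_cons xP g_sym glx gP ltnn => /(_ isT).
Qed.

Lemma longest_nbr_count k l s M : regular g k -> longest (l :: s) -> size (l :: s) <= M ->
  k <= count (fun j => g l (nth l (l :: s) j)) (iota 1 M.-1).
Proof.
move=> reg lP PM; apply: nbr_count reg _ => x /(longest_nbr lP) xP; split=> //.
by apply: leq_trans PM; rewrite index_mem.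
Qed.

Lemma longest_size k l s : 2 <= k -> regular g k -> longest (l :: s) -> 3 <= size (l :: s).
Proof.
move=> k2 reg lP; rewrite leqNgt ltnS; apply/negP=> s2.
by have := leq_trans k2 (longest_nbr_count reg lP s2); rewrite /=; case: (g _ _).
Qed.

Lemma card_compl s : gpath s -> #|~: [set x in s]| = #|T| - size s.
Proof. by case/andP=> /card_uniqP us _; rewrite cardsCs setCK cardsE us. Qed.

(** Cutting off one P_3 leaves [4 * j - 1] vertices, and a tree on them yields [2 * j]. Failing
    that, the neighbours of the detour's end have index 1 or 2; as [2 <= k] both occur, and the end
    can switch colour. *)
Lemma odd_join_mod2 k l s j : 2 <= k -> regular g k -> longest (l :: s) -> #|T| = 4 * j + 2 ->
  odd_join setT (2 * j + 2).
Proof.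
move=> k2 reg lP nT; have P3 := longest_size k2 reg lP.
case: (lP) => gP maxP; have := gpath_size gP; rewrite nT => Pn.
have [//||[A [B [bAB E]]]|[w [Q [i [gW /andP[Qi iN] QP nbrW]]]]] := detour gP maxP (N := 3).
- by rewrite nT; lia.
- rewrite -(setUCr [set x in take 3 (l :: s)]) addnC; apply: odd_joinU.
  + by rewrite -setI_eq0 setICr.
  + by apply: odd_join_path3; rewrite ?gpath_take // size_takel.
  rewrite -E; apply: btree_odd_join; rewrite ?oddM // E card_compl ?gpath_take // size_takel //.
  by rewrite nT; lia.
have nW x : g w x -> x \in w :: (Q ++ drop i (l :: s)) /\
    index x (w :: (Q ++ drop i (l :: s))) < 3.
  by move=> /nbrW[xW ix]; split=> //; apply: leq_trans ix _; lia.
have := leq_trans k2 (nbr_count reg nW); rewrite /=.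
move: gW (fun x gx => (nW x gx).1); rewrite cat_cons.
case: (Q ++ _) => [|x [|y t]] gW nbr; rewrite /= ?g_irr ?addn0 //; first by case: (g w x).
by case gwy: (g w y); [move=> _; exact: (odd_join_switch1 gW nbr gwy nT) | case: (g w x)].
Qed.

(** Two P_3's yield 4, and a tree on the other [4 * j - 5] vertices yields [2 * j - 2]. *)
Lemma odd_join_detour6 P A B j : gpath P -> 6 <= size P -> #|T| = 4 * j + 1 -> btree A B ->
  A :|: B = ~: [set x in take 6 P] -> odd_join setT (2 * j + 2).
Proof.
move=> gP P6 nT bAB E; have := gpath_size gP; rewrite nT => Pn.
have -> : 2 * j + 2 = 4 + 2 * j.-1 by lia.
rewrite -(setUCr [set x in take 6 P]); apply: odd_joinU.
- by rewrite -setI_eq0 setICr.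
- by apply: odd_join_path6; rewrite ?gpath_take // size_takel.
rewrite -E; apply: btree_odd_join; rewrite ?oddM // E card_compl ?gpath_take // size_takel //.
by rewrite nT; lia.
Qed.

Lemma odd_join_mod1_cycle l s j : ~ has_C5 g -> regular g 2 -> longest (l :: s) ->
  #|T| = 4 * j + 1 -> odd_join setT (2 * j + 2).
Proof.
move=> noC5 reg lP nT; have P3 := longest_size (leqnn 2) reg lP.
case: (lP) => gP maxP; have Pn := gpath_size gP.
have [gll allP] := two_regular_path reg gP (longest_nbr lP).
have sP : size (l :: s) = #|T|.
  apply/eqP; rewrite eqn_leq Pn; case/andP: gP => /card_uniqP <- _.
  by apply: subset_leq_card; apply/subsetP=> x _; apply: allP.
(* The only other order that is 1 mod 4 and at least 3 is 5, where the spanning cycle is a C_5. *)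
have n6 : 6 < #|T|.
  rewrite nT ltnNge; apply/negP=> j6; case: noC5; apply: (gpath_C5 gP).
  have s4 : size s = 4 by move: sP P3; rewrite nT /=; lia.
  by rewrite -s4 -last_nth.
have P6 : 0 < 6 <= size (l :: s) by apply/andP; split=> //; rewrite sP ltnW.
have [[A [B [bAB E]]]|[w [Q [i [_ _ QP _]]]]] := detour gP maxP P6 n6.
  by apply: odd_join_detour6 gP _ nT bAB E; case/andP: P6.
by have := QP w (mem_head _ _); rewrite allP.
Qed.

(* The end [w] of the detour has at least 4 neighbours, of index at most 5 on the
   detour, and index 4 would close a C_5: so they have indices 1, 2, 3 and 5, and
   index 5 forces the detour to be as long as the original path. *)
Lemma odd_join_mod1_step k l s j : ~ has_C5 g -> 4 <= k -> regular g k -> longest (l :: s) ->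
  #|T| = 4 * j + 1 ->
  odd_join setT (2 * j + 2) \/ exists w Q x y t, let i := (size Q).+1 in
   [/\ [:: w, x, y & t] = w :: Q ++ drop i (l :: s), longest [:: w, x, y & t],
      g w y, i < size (l :: s) & forall z, z \in w :: Q -> z \notin l :: s].
Proof.
move=> noC5 k4 reg lP nT.
have no4 u p : gpath (u :: p) -> g u (nth u (u :: p) 4) = false.
  by move=> gp; apply/negP=> /(gpath_C5 gp).
case: (lP) => gP maxP; have := gpath_size gP; rewrite nT => Pn.
(* Otherwise the neighbours of [l] have index at most 4 (at index 5 [nth] gives the default [l]),
   and index 4 closes a C_5, which leaves only three. *)
have P6 : 6 <= size (l :: s).
  rewrite leqNgt; apply/negP=> P5.
  have := leq_trans k4 (longest_nbr_count reg lP (ltnW P5)).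
  rewrite [iota _ _]/= [count _ _]/= no4 // [nth l s 4]nth_default // g_irr.
  by do 3!case: (g l _).
have [//||[A [B [bAB E]]]|[w [Q [i [gW /andP[Qi iN] QP nbrW]]]]] := detour gP maxP (N := 6).
- by rewrite nT; lia.
- by left; apply: odd_join_detour6 gP P6 nT bAB E.
right; set W := Q ++ drop i (l :: s) in gW nbrW.
have nW x : g w x -> x \in w :: W /\ index x (w :: W) < 6.
  by move=> /nbrW[xW ix]; split=> //; apply: leq_trans ix _; lia.
have := leq_trans k4 (nbr_count reg nW).
rewrite [iota _ _]/= [count _ _]/= no4 //.
case g2: (g w (nth w (w :: W) 2)); last by case: (g _ _); case: (g _ _); case: (g _ _).
case g5: (g w (nth w (w :: W) 5)); last by case: (g _ _); case: (g _ _).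
move=> _.
have W5 : 5 < size (w :: W).
  by rewrite ltnNge; apply/negP=> /(nth_default w) d; rewrite d g_irr in g5.
(* Index 5 lies below [(size Q).+1 + (6 - i)], which gives [i <= (size Q).+1]; the converse is
   [Qi]. *)
have iQ : i = (size Q).+1.
  have [_] := nbrW _ g5; rewrite index_uniq //; last by case/andP: gW.
  by move: Qi => /=; lia.
have sW : size (w :: W) = size (l :: s).
  rewrite /W -cat_cons size_cat size_drop [size (w :: Q)]/= -iQ subnKC //.
  by apply: leq_trans P6; apply: ltnW.
case EW : W W5 g2 => [|x [|y t]] // _ gwy.
exists w, Q, x, y, t; split=> //.
- by rewrite -EW /W iQ.
- by rewrite -EW; split=> // u /maxP; rewrite sW.
- by rewrite -iQ; apply: leq_trans P6.
Qed.

(** The first rerouting gives a longest path whose end [w] sees its third vertex; rerouting that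
    path gives a second such end [w'] off it. These two are the leaves that switch. *)
Lemma odd_join_mod1 k l s j : ~ has_C5 g -> 4 <= k -> regular g k -> longest (l :: s) ->
  #|T| = 4 * j + 1 -> odd_join setT (2 * j + 2).
Proof.
move=> noC5 k4 reg lP nT.
have [//|[w [_ [x [y [t [_ lW gwy _ _]]]]]]] := odd_join_mod1_step noC5 k4 reg lP nT.
have [//|[w' [Q [x' [y' [t' [E lW' gwy' iP QP]]]]]]] := odd_join_mod1_step noC5 k4 reg lW nT.
case: E => E.
apply: (odd_join_switch2 (i := (size Q).+1) (Q := Q) (w := w')) lW.1 _ gwy _ QP _ _ (esym E) gwy' nT.
- exact: longest_nbr.
- by rewrite iP.
- by rewrite -E; case: lW'.
- by rewrite -E; apply: longest_nbr.
Qed.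

(** [2 * j + 2] is the least even number that is at least n/2 for all four orders n. For n = 3 and 0
    mod 4 any spanning tree gives it. *)
Lemma odd_join_regular k j : ~ has_C5 g -> 2 <= k -> regular g k ->
  4 * j < #|T| <= 4 * j + 4 -> odd_join setT (2 * j + 2).
Proof.
move=> noC5 k2 reg /andP[nl nr].
have [x0 _] : exists x0, x0 \in T by apply/card_gt0P/(leq_ltn_trans _ nl).
have gx0 : gpath [:: x0] by [].
have [[|l s] gP maxP] := longest_seq gx0 gpath_size; first by have := maxP _ gx0.
have lP : longest (l :: s) by [].
have [n1|n1] := eqVneq #|T| (4 * j + 1).
  have := handshake reg; rewrite n1 oddM oddD oddM /= => ek.
  have [k2'|k2'] := eqVneq k 2; first by subst k; apply: odd_join_mod1_cycle lP n1.
  have k4 : 4 <= k by move: k2 k2' ek; case: (k) => [|[|[|[|m]]]].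
  exact: odd_join_mod1 noC5 k4 reg lP n1.
have [n2|n2] := eqVneq #|T| (4 * j + 2); first exact: odd_join_mod2 k2 reg lP n2.
have [||A [B [bAB _ _ E]]] := btree_span (Z := setT) (btree_root x0).
- exact: subsetT.
- by move=> z y; rewrite inE.
rewrite -E; apply: btree_odd_join bAB _ _; first by rewrite oddD oddM.
by rewrite E cardsT; lia.
Qed.
End OddJoins.

(* f_o(L(G)) >= n/2 is stated as n <= 2 * f_o(L(G)) *)
Theorem theorem3p2 (T : finType) (g : rel T) (n k : nat) :
  simple_graph g -> connected g -> #|T| = n -> 2 <= k -> regular g k ->
  ~ has_C5 g ->
  n <= 2 * f_o (line_rel g).
Proof.
case=> g_sym g_irr g_conn nT k2 reg noC5.
have [->//|n0] := posnP n; pose j := n.-1 %/ 4.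
have nj : 4 * j < #|T| <= 4 * j + 4 by rewrite nT /j; lia.
have := odd_join_leq_f_o g_irr (odd_join_regular g_sym g_irr g_conn noC5 k2 reg nj).
by move: nj; rewrite nT; lia.
Qed.
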